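(* Let $K_{1,n}^{r}$ be the $r$-uniform star hypergraph, and let $C_\tau$ denote the transversal coalition number. Then: (i) $C_\tau(K_{1,n}^{r})=r$ if $n=r-1$; (ii) $C_\tau(K_{1,n}^{r})=r+1$ if $n\geq r$.
   Context: A hypergraph $H=(U,\mathcal{E})$ consists of a finite vertex set $U$ and a family $\mathcal{E}$ of subsets of $U$ called (hyper)edges; it is $r$-uniform if every edge has exactly $r$ vertices. The complete bipartite $r$-uniform hypergraph $K^r_{m,n}$ has vertex set $U=U_1\cup U_2$ with $U_1\cap U_2=\emptyset$, $|U_1|=m$, $|U_2|=n$, and edge set $\mathcal{E}=\{e\subset U: |e|=r \text{ and } e\cap U_i\neq\emptyset \text{ for } i=1,2\}$ (where $e\subset U$ allows $e=U$). When $m=1$ it is the $r$-uniform star $K^r_{1,n}$; the unique vertex of $U_1$, called the center, lies in every edge. A transversal of $H$ is a set $T\subseteq U$ with $T\cap e\neq\emptyset$ for every $e\in\mathcal{E}$. Two disjoint sets $A,B\subseteq U$ form a transversal coalition if neither $A$ nor $B$ is a transversal of $H$ but $A\cup B$ is a transversal of $H$. A transversal coalition partition of $H$ is a partition $\varphi=\{P_1,\dots,P_k\}$ of $U$ into nonempty sets such that each $P_i$ either is a singleton that is a transversal of $H$, or is not a transversal of $H$ and forms a transversal coalition with some other (non-transversal) set $P_j\in\varphi$. The transversal coalition number $C_\tau(H)$ is the maximum $k$ for which $H$ has a transversal coalition partition with $k$ parts. *)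

(* Defs.v *)
From mathcomp Require Import all_boot.

Set Implicit Arguments.
Unset Strict Implicit.
Unset Printing Implicit Defensive.

Definition hypergraph (U : finType) := {set {set U}}.

(* The vertex classes U_1 and U_2 are the two summands of ['I_m + 'I_n]. *)
Definition left_class (m n : nat) : {set 'I_m + 'I_n} :=
  [set inl i | i : 'I_m].

Definition right_class (m n : nat) : {set 'I_m + 'I_n} :=
  [set inr j | j : 'I_n].

Definition complete_bipartite (r m n : nat) :
    hypergraph ('I_m + 'I_n)%type :=
  [set e : {set 'I_m + 'I_n} |
    [&& #|e| == r, e :&: left_class m n != set0
      & e :&: right_class m n != set0]].

Definition star (r n : nat) : hypergraph ('I_1 + 'I_n)%type :=
  complete_bipartite r 1 n.

Definition transversal (U : finType) (H : hypergraph U) (T : {set U}) : bool :=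
  [forall e in H, T :&: e != set0].

Definition transversal_coalition (U : finType) (H : hypergraph U)
    (A B : {set U}) : bool :=
  [&& [disjoint A & B], ~~ transversal H A, ~~ transversal H B
    & transversal H (A :|: B)].

(* [partition] already requires the parts to be nonempty. *)
Definition transversal_coalition_partition (U : finType) (H : hypergraph U)
    (P : {set {set U}}) : bool :=
  partition P [set: U] &&
  [forall A in P,
    ((#|A| == 1) && transversal H A)
    || (~~ transversal H A &&
        [exists B in P, (B != A) && transversal_coalition H A B])].

(* The value is 0 when H has no transversal coalition partition, so a
   positive value is always attained as a maximum. *)
Definition coalition_number (U : finType) (H : hypergraph U) : nat :=
  \max_(P : {set {set U}} | transversal_coalition_partition H P) #|P|.

(* Main.v *)
Require Import Defs.
From mathcomp Require Import all_boot.
From mathcomp Require Import zify.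

(** A set is a transversal of the star iff it contains the center or misses
    fewer than [r - 1] leaves.  When [r <= n], the part of a leaf therefore
    needs a partner; the two together have at least [n - r + 2] elements, so
    the at most [r - 1] remaining vertices give at most [r - 1] further parts.
    Equality holds for one block of [n - r + 1] leaves together with singletons.
    When [n = r - 1], every nonempty set is a transversal, and the partition
    into singletons is optimal. *)

Set Implicit Arguments.
Unset Strict Implicit.
Unset Printing Implicit Defensive.

(* [finset] has an unrelated [transversal]. *)
Local Notation transversal := Defs.transversal.

(* Elaboration produces convertible but syntactically different instances of
   the same cardinal, which [lia] would take for distinct atoms. *)
Ltac card_lia :=
  repeat match goal with H : context [card.body] |- _ => revert H end;
  repeat move: #|_| => ?;
  lia.

Lemma exists_subset_card (T : finType) (B : {set T}) (k : nat) :
  k <= #|B| -> exists2 A : {set T}, A \subset B & #|A| = k.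
Proof.
move=> leq_kB.
have /card_gt0P[A] : 0 < #|[set A : {set T} | A \subset B & #|A| == k]|.
  by rewrite cards_draws bin_gt0.
by rewrite inE => /andP[sAB /eqP cardA]; exists A.
Qed.

Lemma leq_card_cover_trivIset (T : finType) (P : {set {set T}}) :
  trivIset P -> set0 \notin P -> #|P| <= #|cover P|.
Proof.
move=> /eqP <- P0; rewrite -sum1_card; apply: leq_sum => A PA.
by rewrite card_gt0; apply: contraNneq P0 => <-.
Qed.

(** The parts other than [A] and [B] are disjoint, nonempty and lie outside [A :|: B], so each uses
    up at least one of the remaining elements of [D]. *)
Lemma leq_card_partition2 (T : finType) (P : {set {set T}}) (D A B : {set T}) :
  partition P D -> A \in P -> B \in P -> A != B ->
  #|P| + #|A :|: B| <= #|D| + 2.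
Proof.
move=> partP PA PB neqAB; have [/eqP covP trivP P0] := and3P partP.
have disAB : [disjoint A & B] by apply: (trivIsetP trivP).
have QB : B \in P :\ A by rewrite !inE eq_sym neqAB.
have sQP : (P :\ A) :\ B \subset P.
  by apply: subset_trans (subsetDl _ _) (subsetDl _ _).
have := leq_card_cover_trivIset (trivIsetS sQP trivP)
  (contra (subsetP sQP _) P0).
rewrite -(eqP (trivIsetS sQP trivP)).
have := card_partition partP; rewrite (big_setD1 A) //= (big_setD1 B) //=.
have := cardsD1 A P; rewrite PA (cardsD1 B (P :\ A)) QB.
rewrite cardsU (disjoint_setI0 disAB) cards0 => -> -> leq_card.
rewrite subn0 addnC (addnA #|A|) -[leqRHS]addnA leq_add2l.
by rewrite !add1n addn2 !ltnS.
Qed.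

Section BlockPartition.

Variables (T : finType) (A : {set T}).

(** For a singleton [A] this is the partition into singletons, so one construction serves both cases
    of the theorem. *)
Definition block_partition : {set {set T}} := A |: [set [set x] | x in ~: A].

Lemma block_partitionP (B : {set T}) :
  reflect (B = A \/ exists2 x, x \notin A & B = [set x])
          (B \in block_partition).
Proof.
apply: (iffP setU1P) => [] [-> | ]; try by left.
  by case/imsetP=> x; rewrite inE; right; exists x.
by case=> x nAx ->; right; apply: imset_f; rewrite inE.
Qed.

Lemma block_partition_partition :
  A != set0 -> partition block_partition [set: T].
Proof.
move=> A_neq0; apply/and3P; split.
- rewrite eqEsubset subsetT; apply/subsetP => x _; apply/bigcupP.
  have [Ax | nAx] := boolP (x \in A).
    by exists A => //; apply/block_partitionP; left.
  by exists [set x]; rewrite ?set11 //; apply/block_partitionP; right; exists x.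
- apply/trivIsetP => B C /block_partitionP[-> | [x nAx ->]]
    /block_partitionP[-> | [y nAy ->]]; rewrite ?eqxx //.
  + by rewrite disjoint_sym disjoints1.
  + by rewrite disjoints1.
  + by rewrite disjoints1 inE; apply: contraNN => /eqP->.
- apply/block_partitionP => -[A0 | [x _ /esym/eqP]].
    by rewrite -A0 eqxx in A_neq0.
  by apply/negP/set0Pn; exists x; rewrite set11.
Qed.

Lemma card_block_partition : #|block_partition| = #|~: A|.+1.
Proof.
rewrite cardsU1 card_imset; last exact: set1_inj.
suff -> : A \notin [set [set x] | x in ~: A] by [].
apply/imsetP => -[x]; rewrite inE => nAx eqA.
by rewrite eqA set11 in nAx.
Qed.

End BlockPartition.

Lemma leq_coalition_number (U : finType) (H : hypergraph U) (P : {set {set U}}) :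
  transversal_coalition_partition H P -> #|P| <= coalition_number H.
Proof. by move=> PH; rewrite /coalition_number (bigD1 P) //= leq_maxl. Qed.

Section Star.

Variables (r n : nat).
Hypothesis r_gt1 : 1 < r.

Definition center : 'I_1 + 'I_n := inl ord0.

Lemma card_star_vertices : #|[set: 'I_1 + 'I_n]| = n.+1.
Proof. by rewrite cardsT card_sum !card_ord. Qed.

(** Since [1 < r], an edge through the center has a second vertex, necessarily a leaf, so it meets
    both classes. *)
Lemma in_star (e : {set 'I_1 + 'I_n}) :
  (e \in star r n) = (#|e| == r) && (center \in e).
Proof.
rewrite inE; have [card_e | //] := eqVneq #|e| r; rewrite /=.
apply/andP/idP => [[/set0Pn[x /setIP[ex /imsetP[i _ eqx]]] _] | ec].
  by rewrite eqx (ord1 i) in ex.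
split; apply/set0Pn.
  by exists center; rewrite inE ec; apply: imset_f.
have /card_gt0P[[i | j]] : 0 < #|e :\ center|.
- by have := cardsD1 center e; rewrite ec card_e; card_lia.
- by rewrite !inE (ord1 i) eqxx.
- by rewrite !inE => /andP[_ ej]; exists (inr j); rewrite inE ej; apply: imset_f.
Qed.

(** An edge avoiding [T] is the center with [r.-1] leaves outside [T]. If [T] misses the center,
    there are [n - #|T|] such leaves; the additive form avoids truncated subtraction. *)
Lemma transversal_star (T : {set 'I_1 + 'I_n}) :
  transversal (star r n) T = (center \in T) || (n < #|T| + r.-1).
Proof.
have [Tc | nTc] := boolP (center \in T).
  apply/forall_inP => e; rewrite in_star => /andP[_ ec].
  by apply/set0Pn; exists center; rewrite inE Tc.
have cardCT : #|T| + #|~: T :\ center| = n.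
  have := cardsD1 center (~: T); rewrite inE nTc.
  by have := cardsC T; rewrite -cardsT card_star_vertices; card_lia.
apply/forall_inP/idP => /= [trT | ltn].
  rewrite ltnNge; apply/negP => le_n.
  have [|A sA cardA] := @exists_subset_card _ (~: T :\ center) r.-1.
    by card_lia.
  have /subsetD1P[sAT nAc] := sA.
  suff /trT/negP[] : center |: A \in star r n.
    rewrite setIUr setU_eq0 setI_eq0 disjoint_sym disjoints1 nTc.
    by rewrite setI_eq0 disjoint_sym disjoints_subset.
  by rewrite in_star setU11 cardsU1 nAc cardA andbT; card_lia.
move=> e; rewrite in_star => /andP[/eqP card_e ec].
apply/negP; rewrite setI_eq0 disjoint_sym disjoints_subset => seT.
have := subset_leq_card (setSD [set center] seT).
by have := cardsD1 center e; rewrite ec; card_lia.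
Qed.

Lemma coalition_partition_star_upper (P : {set {set 'I_1 + 'I_n}}) :
  r <= n -> transversal_coalition_partition (star r n) P -> #|P| <= r.+1.
Proof.
move=> le_rn /andP[partP /forall_inP coalP].
have n_gt0 : 0 < n by card_lia.
pose leaf : 'I_1 + 'I_n := inr (Ordinal n_gt0).
have /bigcupP[A PA Aleaf] : leaf \in cover P by rewrite (cover_partition partP) inE.
have /orP[/andP[/cards1P[x eqA]] | ] := coalP _ PA.
  (* A single leaf is a transversal only if [n < r]. *)
  by move: Aleaf; rewrite eqA inE transversal_star cards1 inE => /eqP<- /=; card_lia.
case/andP=> _ /exists_inP[B PB /andP[neqBA /and4P[_]]].
(* Neither [A] nor [B] contains the center, so their union is a transversal by size alone:
   [n < #|A :|: B| + r.-1]. *)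
rewrite !transversal_star inE !negb_or => /andP[/negPf-> _] /andP[/negPf-> _] /=.
rewrite eq_sym in neqBA.
have := leq_card_partition2 partP PA PB neqBA; rewrite card_star_vertices.
card_lia.
Qed.

Lemma block_partition_center_coalition :
  n = r.-1 ->
  transversal_coalition_partition (star r n) (block_partition [set center]).
Proof.
move=> eq_n; apply/andP; split.
  by apply: block_partition_partition; apply/set0Pn; exists center; rewrite set11.
by apply/forall_inP => B /block_partitionP[-> | [x _ ->]];
  rewrite transversal_star cards1 -eq_n add1n leqnn orbT.
Qed.

(** The size [n - r.-1] is the largest for a non-transversal: any further leaf completes [A] to a
    transversal. The center is a part of its own, a singleton transversal. *)
Lemma block_partition_leaves_coalition (A : {set 'I_1 + 'I_n}) :
  r <= n -> center \notin A -> #|A| = n - r.-1 ->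
  transversal_coalition_partition (star r n) (block_partition A).
Proof.
move=> le_rn nAc cardA.
have A_neq0 : A != set0 by rewrite -card_gt0 cardA; card_lia.
have ntA : ~~ transversal (star r n) A.
  by rewrite transversal_star (negPf nAc) cardA /=; card_lia.
have PA : A \in block_partition A by apply/block_partitionP; left.
have coal x : x \notin A -> x != center ->
    [/\ [set x] \in block_partition A, [set x] != A,
        transversal_coalition (star r n) A [set x]
      & transversal_coalition (star r n) [set x] A].
  move=> nAx x_c; split.
  - by apply/block_partitionP; right; exists x.
  - by apply: contraNneq nAx => <-; rewrite set11.
  - rewrite /transversal_coalition ntA disjoint_sym disjoints1 nAx.
    rewrite !transversal_star !inE eq_sym (negPf x_c) (negPf nAc) cards1.
    by rewrite setUC cardsU1 nAx cardA /=; card_lia.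
  - rewrite /transversal_coalition ntA disjoints1 nAx !transversal_star.
    rewrite !inE eq_sym (negPf x_c) (negPf nAc) cards1.
    by rewrite cardsU1 nAx cardA /=; card_lia.
apply/andP; split; first exact: block_partition_partition.
apply/forall_inP => B /block_partitionP[-> | [x nAx ->]].
  (* Exactly [r.-1] leaves lie outside [A], and [1 < r] makes one available as a partner. *)
  have /card_gt0P[x] : 0 < #|~: A :\ center|.
    have := cardsD1 center (~: A); rewrite inE nAc.
    by have := cardsC A; rewrite -cardsT card_star_vertices cardA; card_lia.
  rewrite !inE => /andP[x_c nAx]; have [Px neq cAx _] := coal x nAx x_c.
  by rewrite ntA; apply/orP; right; apply/exists_inP; exists [set x]; rewrite ?neq.
have [-> | x_c] := eqVneq x center.
  by rewrite cards1 transversal_star set11.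
have [_ neq _ cxA] := coal x nAx x_c.
have /and4P[_ -> _ _] := cxA.
apply/orP; right; apply/exists_inP; exists A => //.
by rewrite eq_sym neq.
Qed.

End Star.

Theorem theorem3 (r n : nat) (hr : 2 <= r) :
  (n = r - 1 -> coalition_number (star r n) = r) /\
  (r <= n -> coalition_number (star r n) = r + 1).
Proof.
split=> [eq_n | le_rn]; apply/eqP; rewrite eqn_leq; apply/andP; split.
(* Here there are only [n + 1 = r] vertices to distribute among nonempty parts. *)
- apply/bigmax_leqP => P /andP[/and3P[/eqP covP trivP P0] _].
  have := leq_card_cover_trivIset trivP P0; rewrite covP card_star_vertices.
  card_lia.
- have eq_n' : n = r.-1 by card_lia.
  have := leq_coalition_number (block_partition_center_coalition hr eq_n').
  rewrite card_block_partition.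
  have := cardsC [set center n]; rewrite cards1 -cardsT card_star_vertices.
  card_lia.
- by apply/bigmax_leqP => P; rewrite addn1; apply: coalition_partition_star_upper.
(* With [n - r.-1] leaves in the block, [r] vertices stay outside it, which gives [r + 1] parts. *)
- have [|A sA cardA] := @exists_subset_card _ (~: [set center n]) (n - r.-1).
    have := cardsC [set center n]; rewrite cards1 -cardsT card_star_vertices.
    by card_lia.
  have nAc : center n \notin A by rewrite -disjoints1 disjoint_sym disjoints_subset.
  have := leq_coalition_number (block_partition_leaves_coalition hr le_rn nAc cardA).
  rewrite card_block_partition.
  have := cardsC A; rewrite cardA -cardsT card_star_vertices; card_lia.
Qed.
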